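(* If a sequence of finite graphs $(G_i)_{i\in\mathbb N}$ converges to a finite graph $H$ in the asymptotic spectrum distance, then $(\Theta(G_i))_{i\in\mathbb N}$ converges to $\Theta(H)$.
   Context: Graphs here are finite and simple. $E_n$ denotes the graph with $n$ vertices and no edges, $G\sqcup H$ the disjoint union, and $G\boxtimes H$ the strong product: its vertex set is $V(G)\times V(H)$, and distinct $(a,x),(b,y)$ are adjacent iff ($a=b$ or $\{a,b\}\in E(G)$) and ($x=y$ or $\{x,y\}\in E(H)$). A cohomomorphism $G\to H$ is a map $f:V(G)\to V(H)$ such that for all distinct non-adjacent $u,v\in V(G)$ the vertices $f(u),f(v)$ are distinct and non-adjacent in $H$. Write $G\le H$ if there is a cohomomorphism $G\to H$. $\alpha$ is the independence number, and $\Theta(G)=\lim_{n\to\infty}\alpha(G^{\boxtimes n})^{1/n}$ is the Shannon capacity. The asymptotic spectrum of graphs $\mathcal X$ is the set of all maps $F$ from finite graphs to $\mathbb R_{\ge 0}$ with $F(G\sqcup H)=F(G)+F(H)$, $F(G\boxtimes H)=F(G)F(H)$, $F(E_n)=n$ for all $n\in\mathbb N$, and $G\le H\Rightarrow F(G)\le F(H)$. The asymptotic spectrum distance is $d(G,H)=\sup_{F\in\mathcal X}|F(G)-F(H)|$, and $G_i$ converges to $H$ if $d(G_i,H)\to0$. *)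

(* Defs.v *)
From HB Require Import structures.
From mathcomp Require Import all_boot all_order all_algebra.
From mathcomp Require Import all_classical all_reals all_analysis.

Set Implicit Arguments.
Unset Strict Implicit.
Unset Printing Implicit Defensive.

Import Order.TTheory GRing.Theory Num.Theory.
Import numFieldNormedType.Exports.

Local Open Scope classical_set_scope.
Local Open Scope ring_scope.

Record sgraph := SGraph {
  vertex :> finType;
  adj : rel vertex;
  adj_sym : symmetric adj;
  adj_irr : irreflexive adj }.

Section Constructions.
Variables G H : sgraph.

Definition sunion_adj (u v : G + H) : bool :=
  match u, v with
  | inl a, inl b => adj a b
  | inr x, inr y => adj x y
  | _, _ => false
  end.

Lemma sunion_adj_sym : symmetric sunion_adj.
Proof. by move=> [a|x] [b|y] //=; rewrite adj_sym. Qed.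

Lemma sunion_adj_irr : irreflexive sunion_adj.
Proof. by move=> [a|x] /=; rewrite adj_irr. Qed.

Definition sunion : sgraph := SGraph sunion_adj_sym sunion_adj_irr.

Definition strong_adj (u v : G * H) : bool :=
  [&& u != v, (u.1 == v.1) || adj u.1 v.1 & (u.2 == v.2) || adj u.2 v.2].

Lemma strong_adj_sym : symmetric strong_adj.
Proof.
move=> u v; rewrite /strong_adj (eq_sym v) (eq_sym v.1) (eq_sym v.2).
by rewrite (adj_sym v.1) (adj_sym v.2).
Qed.

Lemma strong_adj_irr : irreflexive strong_adj.
Proof. by move=> u; rewrite /strong_adj eqxx. Qed.

Definition strong_prod : sgraph := SGraph strong_adj_sym strong_adj_irr.

Definition cohom (f : G -> H) : Prop :=
  forall u v : G, u != v -> ~~ adj u v -> f u != f v /\ ~~ adj (f u) (f v).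

Definition cohom_le : Prop := exists f : G -> H, cohom f.

End Constructions.

Lemma edgeless_adj_sym n : symmetric (fun _ _ : 'I_n => false).
Proof. by []. Qed.

Lemma edgeless_adj_irr n : irreflexive (fun _ _ : 'I_n => false).
Proof. by []. Qed.

Definition edgeless (n : nat) : sgraph :=
  SGraph (@edgeless_adj_sym n) (@edgeless_adj_irr n).

Fixpoint strong_pow (G : sgraph) (n : nat) : sgraph :=
  if n is m.+1 then strong_prod G (strong_pow G m) else edgeless 1.

Definition independent (G : sgraph) (A : {set G}) : bool :=
  [forall x in A, forall y in A, ~~ adj x y].

Definition indep_num (G : sgraph) : nat :=
  \max_(A : {set G} | independent A) #|A|.

Definition shannon_capacity (R : realType) (G : sgraph) : R :=
  lim ((indep_num (strong_pow G n))%:R `^ (n%:R^-1) @[n --> \oo]).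

(* The asymptotic spectrum, as a predicate: set (sgraph -> R) is a universe
   inconsistency, because finType lies above the universe of set. *)
Record asymptotic_spectrum (R : realType) (F : sgraph -> R) : Prop :=
    AsymptoticSpectrum {
  spectral_ge0 : forall G, 0 <= F G;
  spectral_union : forall G H, F (sunion G H) = F G + F H;
  spectral_prod : forall G H, F (strong_prod G H) = F G * F H;
  spectral_edgeless : forall n, F (edgeless n) = n%:R;
  spectral_le : forall G H, cohom_le G H -> F G <= F H }.

(* The supremum is taken in \bar R, so that it carries no boundedness side
   condition; it is in fact at most maxn #|G| #|H|. *)
Definition spectrum_dist (R : realType) (G H : sgraph) : \bar R :=
  ereal_sup [set x | exists2 F : sgraph -> R,
    asymptotic_spectrum F & x = (`|F G - F H|)%:E].

(* Main.v *)
Require Import Defs.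
From HB Require Import structures.
From mathcomp Require Import all_boot all_order all_algebra.
From mathcomp Require Import all_classical all_reals all_analysis.
From mathcomp Require Import ring lra.

Set Implicit Arguments.
Unset Strict Implicit.
Unset Printing Implicit Defensive.

Import Order.TTheory GRing.Theory Num.Theory.
Import numFieldNormedType.Exports.
Local Open Scope classical_set_scope.
Local Open Scope ring_scope.

(** The Shannon capacity is an infimum over the asymptotic spectrum:
    [Theta(G) = inf_F F(G)] (Strassen duality, [shannon_capacityE]).  An infimum
    of functions is 1-Lipschitz for the uniform distance, so
    [|Theta(G) - Theta(H)| <= d(G, H)], and convergence in [d] forces convergence
    of the capacities.

    The duality comes from an alternative, [spectral_dichotomy].  In a
    commutative semiring with a suitable compatible preorder [le], fix an element
    [a] and a rational [m / s], and try to add the relation [s a <= m].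
    - If the enlarged preorder still separates the natural numbers, Zorn's lemma
      extends it to a maximal one.  A maximal preorder is total
      ([maximal_total]), and comparison with the rationals then defines a monotone
      semiring homomorphism to the reals ([cut_point_spectral]).  This is a
      spectral point with [s phi(a) <= m].
    - Otherwise there is a collapse [n + 1 + t m <= n + t s a], which amplifies to
      [(k m)^N <= c ((k + n) s)^N a^N] for all [k] and [N]
      ([defect_growth]): up to a subexponential factor, [a^N] is at least
      [(m / s)^N].

    For the semiring of finite graphs up to cohomomorphic equivalence and [a] the
    class of [G], the first case gives [F] in the spectrum with [F(G) <= m / s].
    In the second case [alpha(G^N)] eventually exceeds [x^N] for every
    [x < m / s].  Since [alpha(G^N) <= F(G)^N] for every [F], letting [m / s]
    approach [inf_F F(G)] from below shows at once that [alpha(G^N)^(1/N)]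
    converges and that its limit is this infimum.

    Graphs range over a large type, to which Zorn's lemma cannot be applied.  The
    semiring is therefore built on codes of graphs with vertex set [{0,...,n-1}],
    and a spectral point is carried back to all graphs through their codes. *)

(** * Strassen preorders and their total extensions *)

(** The conditions under which Strassen's theory applies: [sp_eq0_ge1] and
    [sp_arch] make every nonzero element comparable to a natural number on both
    sides, and [sp_strict] says that the preorder does not collapse the natural
    numbers. *)
Record strassen_preorder (T : comPzSemiRingType) (le : T -> T -> Prop) : Prop :=
    StrassenPreorder {
  sp_refl : forall x, le x x;
  sp_trans : forall y x z, le x y -> le y z -> le x z;
  sp_add : forall z x y, le x y -> le (x + z) (y + z);
  sp_mul : forall z x y, le x y -> le (x * z) (y * z);
  sp_ge01 : le 0 1;
  sp_eq0_ge1 : forall x, x = 0 \/ le 1 x;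
  sp_arch : forall x, exists n, le x n%:R;
  sp_strict : forall n, ~ le n.+1%:R n%:R }.

Arguments sp_trans {T le} _ {y x z}.
Arguments sp_add {T le} _ z {x y}.
Arguments sp_mul {T le} _ z {x y}.

Section StrassenPreorder.
Variables (T : comPzSemiRingType) (le : T -> T -> Prop).
Hypothesis Sle : strassen_preorder le.

Lemma sp_eq x y x' y' : le x y -> x = x' -> y = y' -> le x' y'.
Proof. by move=> xy <- <-. Qed.

Lemma sp_ge0 x : le 0 x.
Proof.
case: (sp_eq0_ge1 Sle x) => [->|]; first exact: sp_refl.
exact: (sp_trans Sle (sp_ge01 Sle)).
Qed.

Lemma sp_addl x y : le x (y + x).
Proof. by have := sp_add Sle x (sp_ge0 y); rewrite add0r. Qed.

Lemma sp_addr x y : le x (x + y).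
Proof. by rewrite addrC; exact: sp_addl. Qed.

Lemma sp_add2 x y z t : le x y -> le z t -> le (x + z) (y + t).
Proof.
move=> /(sp_add Sle z) xy /(sp_add Sle y); rewrite [z + y]addrC [t + y]addrC.
exact: (sp_trans Sle).
Qed.

Lemma sp_mul2 x y z t : le x y -> le z t -> le (x * z) (y * t).
Proof.
move=> /(sp_mul Sle z) xy /(sp_mul Sle y); rewrite [z * y]mulrC [t * y]mulrC.
exact: (sp_trans Sle).
Qed.

Lemma sp_nat m n : le m%:R n%:R <-> (m <= n)%N.
Proof.
split=> [mn|/subnK <-]; last by rewrite natrD; exact: sp_addl.
rewrite leqNgt; apply/negP => /subnK nm; apply: (sp_strict Sle (n := n)).
by apply: (sp_trans Sle) mn; rewrite -nm natrD; exact: sp_addl.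
Qed.

(** A nonzero [w] is at least [1], so absorbing it once into [d] means absorbing
    any natural number into [d]; this contradicts an upper bound of [d]. *)
Lemma sp_absorb w d : le (w + d) d -> w = 0.
Proof.
move=> wd; have [//|w1] := sp_eq0_ge1 Sle w.
have kwd k : le (k%:R * w + d) d.
  elim: k => [|k IHk]; first by rewrite mul0r add0r; exact: sp_refl.
  apply: (sp_trans Sle) wd; have := sp_add Sle w IHk.
  by rewrite -natr1 mulrDl mul1r addrAC [d + w]addrC.
have [N dN] := sp_arch Sle d; case: (sp_strict Sle (n := N)).
apply: (sp_trans Sle) dN; apply: (sp_trans Sle) (kwd N.+1).
apply: (sp_trans Sle) (sp_addr _ d).
by have := sp_mul2 (sp_refl Sle N.+1%:R) w1; rewrite mulr1.
Qed.

(** The relation [a <= b] would give [y + s a <= y + s b], so that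
    [x + s b <= y + s a] yields [x <= y] once the summand [s b] is cancelled. *)
Definition adjoin (a b x y : T) : Prop := exists s, le (x + s * b) (y + s * a).

Lemma sub_adjoin a b x y : le x y -> adjoin a b x y.
Proof. by move=> xy; exists 0; rewrite !mul0r !addr0. Qed.

Lemma adjoin_le a b : adjoin a b a b.
Proof. by exists 1; rewrite !mul1r addrC; exact: sp_refl. Qed.

Lemma adjoin_strassen a b :
  (forall n s, ~ le (n.+1%:R + s * b) (n%:R + s * a)) ->
  strassen_preorder (adjoin a b).
Proof.
move=> nab; split=> [x|y x z [s xy] [t yz]|z x y [s xy]|z x y [s xy]||x|x|n].
- exact: sub_adjoin (sp_refl Sle _).
- exists (s + t); apply: (@sp_trans _ _ Sle (y + s * a + t * b)).
    by have := sp_add Sle (t * b) xy; rewrite mulrDl addrA.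
  by apply: sp_eq (sp_add Sle (s * a) yz) _ _; ring.
- by exists s; have := sp_add Sle z xy; rewrite !(addrAC _ z).
- by exists (s * z); have := sp_mul Sle z xy; rewrite !mulrDl !(mulrAC _ z).
- exact: sub_adjoin (sp_ge01 Sle).
- by have [->|x1] := sp_eq0_ge1 Sle x; [left|right; exact: sub_adjoin].
- by have [n xn] := sp_arch Sle x; exists n; exact: sub_adjoin.
- by case=> s; exact: nab.
Qed.

(** Only the strictness of [sp_strict] can be lost by adjoining a relation. *)
Lemma adjoin_defect a b :
  ~ strassen_preorder (adjoin a b) ->
  exists n s, le (n.+1%:R + s * b) (n%:R + s * a).
Proof.
move=> nS; apply: contrapT => nex; apply: nS; apply: adjoin_strassen => n s ns.
by apply: nex; exists n, s.
Qed.

Lemma defect_coef_ge1 n s x y : le (n.+1%:R + s * x) (n%:R + s * y) -> le 1 s.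
Proof.
have [->|//] := sp_eq0_ge1 Sle s.
by rewrite !mul0r !addr0 => /(sp_strict Sle).
Qed.

(** If [a] and [b] are incomparable, then adjoining [a <= b] and adjoining
    [b <= a] both collapse the natural numbers, with coefficients [s] and [t].
    Multiplying the first collapse by [t] and the second by [s] makes the terms
    [s t a] and [s t b] occur on both sides of the sum, which is then an
    absorption of [s + t]. *)
Lemma maximal_total :
  (forall le', strassen_preorder le' -> (forall x y, le x y -> le' x y) ->
     forall x y, le' x y -> le x y) ->
  forall a b, le a b \/ le b a.
Proof.
move=> maxle.
have defect a b : ~ le a b -> exists n s, le (n.+1%:R + s * b) (n%:R + s * a).
  move=> nab; apply: adjoin_defect => Sab; apply: nab.
  by apply: maxle Sab _ _ _ (adjoin_le a b) => x y; exact: sub_adjoin.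
move=> a b; have [|/defect[n [s sba]]] := pselect (le a b); first by left.
have [|/defect[m [t tab]]] := pselect (le b a); first by right.
have s1 := defect_coef_ge1 sba; exfalso; apply: (sp_strict Sle (n := 0)).
have: s + t = 0.
  apply: (@sp_absorb _ (n%:R * t + m%:R * s + s * t * (a + b))).
  by apply: sp_eq (sp_add2 (sp_mul Sle t sba) (sp_mul Sle s tab)) _ _; ring.
by move=> st0; have := sp_addr s t; rewrite st0; exact: sp_trans s1.
Qed.

End StrassenPreorder.

(** Zorn's lemma is applied to the sets of pairs whose union with [le] is a
    Strassen preorder, so that the empty chain has [le] itself as its bound. *)
Lemma strassen_total_ext (T : comPzSemiRingType) (le : T -> T -> Prop) :
  strassen_preorder le ->
  exists le', [/\ strassen_preorder le', forall x y, le x y -> le' x y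
    & forall x y, le' x y \/ le' y x].
Proof.
move=> Sle; pose ext (E : set (T * T)) x y := le x y \/ E (x, y).
have [|A [SA Amax]] := @Zorn_bigcup (T * T) (fun E => strassen_preorder (ext E)).
  move=> F FS Ftot; have [->|/set0P[E0 FE0]] := eqVneq F set0.
    suff -> : ext (\bigcup_(X in set0) X) = le by [].
    rewrite bigcup_set0; apply/funext => x; apply/funext => y.
    by apply/propext; split=> [[]|]; last left.
  pose U := ext (\bigcup_(X in F) X).
  have UE x y : U x y -> exists2 E, F E & ext E x y.
    by case=> [xy|[E FE Exy]]; [exists E0 => //; left|exists E => //; right].
  have EU E x y : F E -> ext E x y -> U x y.
    by move=> FE [xy|Exy]; [left|right; exists E].
  split.
  - by move=> x; left; exact: sp_refl.
  - move=> y x z /UE[E1 FE1 E1xy] /UE[E2 FE2 E2yz].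
    have [E12|E21] := Ftot _ _ FE1 FE2.
      apply: (EU E2) => //; apply: (sp_trans (FS _ FE2)) E2yz.
      by case: E1xy => [|/E12]; [left|right].
    apply: (EU E1) => //; apply: (sp_trans (FS _ FE1) E1xy).
    by case: E2yz => [|/E21]; [left|right].
  - move=> z x y /UE[E FE Exy]; apply: (EU _ _ _ FE).
    exact: sp_add (FS _ FE) _ _ _ _.
  - move=> z x y /UE[E FE Exy]; apply: (EU _ _ _ FE).
    exact: sp_mul (FS _ FE) _ _ _ _.
  - by left; exact: sp_ge01.
  - by move=> x; have [->|x1] := sp_eq0_ge1 Sle x; [left|right; left].
  - by move=> x; have [n xn] := sp_arch Sle x; exists n; left.
  - by move=> n /UE[E FE]; exact: sp_strict (FS _ FE) n.
exists (ext A); split=> // [x y|]; first by left.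
apply: maximal_total => // le' Sle' lele' x y xy; right.
pose B := [set p : T * T | le' p.1 p.2].
have AB : A `<=` B by move=> [u v] Auv; apply: lele'; right.
apply: contrapT => nAxy; apply: (Amax B).
  by rewrite properEneq; split=> //; apply: contra_notN nAxy => /eqP ->.
suff -> : ext B = le' by [].
apply/funext => u; apply/funext => v; apply/propext.
by split=> [[uv|//]|]; [apply: lele'; left|right].
Qed.

(** * The spectral point of a total preorder *)

Record spectral_point (R : realType) (T : comPzSemiRingType)
    (le : T -> T -> Prop) (phi : T -> R) : Prop := SpectralPoint {
  pt_add : forall x y, phi (x + y) = phi x + phi y;
  pt_mul : forall x y, phi (x * y) = phi x * phi y;
  pt_nat : forall n, phi n%:R = n%:R;
  pt_le : forall x y, le x y -> phi x <= phi y }.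

Lemma archi_scale_le (R : archiRealFieldType) (u v c : R) :
  (forall s : nat, (0 < s)%N -> s%:R * u <= s%:R * v + c) -> u <= v.
Proof.
move=> uvc; rewrite leNgt; apply/negP => vu.
have [s] : exists s : nat, `|c| / (u - v) < s%:R.
  by eexists; apply: archi_boundP; rewrite divr_ge0 // subr_ge0 ltW.
rewrite ltr_pdivrMr ?subr_gt0// => cs.
have c0 : 0 < s.+1%:R * (u - v) - c.
  rewrite subr_gt0 (le_lt_trans (ler_norm c))// (lt_le_trans cs)//.
  by rewrite ler_wpM2r ?ler_nat// subr_ge0 ltW.
by have := uvc s.+1 isT; lra.
Qed.

Section CutPoint.
Variables (R : realType) (T : comPzSemiRingType) (le : T -> T -> Prop).
Hypotheses (Sle : strassen_preorder le) (tot : forall x y, le x y \/ le y x).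

Definition cut (x : T) : set R :=
  [set q | exists r s : nat,
    [/\ (0 < s)%N, le (s%:R * x) r%:R & q = r%:R / s%:R]].

Definition cut_point (x : T) : R := inf (cut x).

Lemma cut_point_le x (r s : nat) :
  le (s%:R * x) r%:R -> s%:R * cut_point x <= r%:R.
Proof.
case: s => [|s] xr; first by rewrite mul0r ler0n.
rewrite mulrC -ler_pdivlMr ?ltr0n//; apply: ge_inf.
  by exists 0 => _ [r' [s' [s0 _ ->]]]; rewrite divr_ge0.
by exists r, s.+1.
Qed.

Lemma cut_point_ge x (r s : nat) :
  le r%:R (s%:R * x) -> r%:R <= s%:R * cut_point x.
Proof.
case: s => [|s] rx.
  suff /eqP -> : r == 0%N by rewrite mul0r.
  by rewrite -leqn0; apply/(sp_nat Sle); move: rx; rewrite mul0r.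
rewrite mulrC -ler_pdivrMr ?ltr0n//; apply: lb_le_inf.
  have [n xn] := sp_arch Sle x; exists (n%:R / 1); exists n, 1%N; split=> //.
  by rewrite mul1r.
move=> _ [r' [s' [s0 xr' ->]]].
rewrite ler_pdivrMr ?ltr0n// mulrAC ler_pdivlMr ?ltr0n// -!natrM ler_nat.
apply/(sp_nat Sle); rewrite !natrM; apply: (sp_trans Sle) (sp_mul Sle _ xr').
by apply: sp_eq (sp_mul Sle s'%:R rx) _ _; ring.
Qed.

(** The integer part of [s x] for a total preorder: it approximates
    [s * cut_point x] to within [1], uniformly in [s], and a product of two such
    approximations has an error that is only linear in [s], at the scale [s ^ 2].
    The identities of [cut_point_spectral] follow by letting [s] grow. *)
Lemma cut_approx x (s : nat) : exists r : nat,
  [/\ le r%:R (s%:R * x), le (s%:R * x) r.+1%:R,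
    r%:R <= s%:R * cut_point x & s%:R * cut_point x <= r.+1%:R].
Proof.
suff [r [rx xr]] : exists r : nat, le r%:R (s%:R * x) /\ le (s%:R * x) r.+1%:R.
  by exists r; split=> //; [exact: cut_point_ge|exact: cut_point_le].
have [n] := sp_arch Sle (s%:R * x).
elim: n => [|n IHn] xn.
  exists 0%N; split; first exact: sp_ge0.
  by apply: (sp_trans Sle xn); exact: sp_ge0.
by have [/IHn|nx] := tot (s%:R * x) n%:R; last by exists n.
Qed.

Lemma cut_point_spectral : spectral_point le cut_point.
Proof.
split=> [x y|x y|n|x y xy].
- apply/le_anti/andP; split; apply: (@archi_scale_le _ _ _ 2) => s s0;
    have [r [rx xr px px']] := cut_approx x s;
    have [q [qy yq py py']] := cut_approx y s.
    have := @cut_point_le (x + y) (r.+1 + q.+1) s.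
    rewrite mulrDr !natrD => /(_ (sp_add2 Sle xr yq)).
    by move: px py; rewrite -!natr1; lra.
  have := @cut_point_ge (x + y) (r + q) s.
  rewrite mulrDr !natrD => /(_ (sp_add2 Sle rx qy)).
  by move: px' py'; rewrite -!natr1; lra.
- apply/le_anti/andP; split;
    apply: (@archi_scale_le _ _ _ (cut_point x + cut_point y + 1)) => s s0;
    have [r [rx xr px px']] := cut_approx x s;
    have [q [qy yq py py']] := cut_approx y s;
    rewrite -(@ler_pM2l _ s%:R) ?ltr0n//;
    have s1 : 1 <= s%:R :> R by rewrite ler1n.
    have xyrq : le ((s * s)%:R * (x * y)) (r.+1 * q.+1)%:R.
      by apply: sp_eq (sp_mul2 Sle xr yq) _ _; ring.
    have := cut_point_le xyrq.
    have := ler_pM (ler0n _ r) (ler0n _ q) px py.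
    by rewrite !natrM -!natr1; lra.
  have rqxy : le (r * q)%:R ((s * s)%:R * (x * y)).
    by apply: sp_eq (sp_mul2 Sle rx qy) _ _; ring.
  have := cut_point_ge rqxy.
  have rq (p : nat) u : 0 <= p%:R * cut_point u.
    by apply: (@cut_point_ge u 0); exact: sp_ge0.
  have := ler_pM (rq s x) (rq s y) px' py'.
  by rewrite !natrM -!natr1; lra.
- have n1 : 1%:R * n%:R = n%:R :> T by rewrite mul1r.
  have hi := @cut_point_le n%:R n 1; have lo := @cut_point_ge n%:R n 1.
  rewrite !n1 !mul1r in hi lo.
  by apply/le_anti; rewrite hi ?lo//; exact: sp_refl.
- apply: (@archi_scale_le _ _ _ 1) => s _.
  have [r [rx xr px px']] := cut_approx x s.
  have ry : le r%:R (s%:R * y).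
    by apply: (sp_trans Sle rx); exact: sp_mul2 (sp_refl Sle _) xy.
  by have := cut_point_ge ry; move: px'; rewrite -natr1; lra.
Qed.

End CutPoint.

(** * The spectral dichotomy *)

Section Duality.
Variables (T : comPzSemiRingType) (le : T -> T -> Prop).
Hypothesis Sle : strassen_preorder le.

Lemma sp_cancel_exp x y t N :
  le (x * t) (y * t) -> le (x ^+ N * t) (y ^+ N * t).
Proof.
move=> xy; elim: N => [|N IHN]; first by rewrite !expr0; exact: sp_refl.
rewrite !exprS; apply: (@sp_trans _ _ Sle (x * (y ^+ N * t))).
  by rewrite -mulrA; exact: sp_mul2 (sp_refl Sle x) IHN.
by apply: sp_eq (sp_mul Sle (y ^+ N) xy) _ _; ring.
Qed.

(** A common summand [z] need be paid for only once, however often the inequality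
    is used; for large [k] its weight is negligible. *)
Lemma sp_iter_cancel x y z (k : nat) :
  le (z + x) (z + y) -> le (z + k%:R * x) (z + k%:R * y).
Proof.
move=> xy; elim: k => [|k IHk]; first by rewrite !mul0r; exact: sp_refl.
apply: (@sp_trans _ _ Sle (z + k%:R * y + x)).
  by apply: sp_eq (sp_add Sle x IHk) _ _; ring.
by apply: sp_eq (sp_add Sle (k%:R * y) xy) _ _; ring.
Qed.

(** A collapse says that [t m] is below [t b] up to a common summand [n].  By
    iteration, [k t m <= n + k t b <= (k + n) t b], as [1 <= t b].  The factor [t]
    survives only once when the [N]-th power is taken, whence a constant [c]
    that depends on neither [k] nor [N]. *)
Lemma defect_growth b (m n : nat) t :
  le (n.+1%:R + t * m%:R) (n%:R + t * b) ->
  exists c : nat, forall k N,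
    le ((k * m) ^ N)%:R (c%:R * ((k + n)%:R * b) ^+ N).
Proof.
move=> ntb; have t1 := defect_coef_ge1 Sle ntb.
have tb1 : le 1 (t * b).
  have [tb0|//] := sp_eq0_ge1 Sle (t * b); case: (sp_strict Sle (n := n)).
  by move: ntb; rewrite tb0 addr0; apply: (sp_trans Sle); exact: sp_addr.
have ntb' : le (n%:R + t * m%:R) (n%:R + t * b).
  apply: (sp_trans Sle) ntb; apply: (sp_add Sle); exact/(sp_nat Sle).
have [c tc] := sp_arch Sle t; exists c => k N.
have step : le ((k * m)%:R * t) ((k + n)%:R * b * t).
  apply: (@sp_trans _ _ Sle (n%:R + k%:R * (t * m%:R))).
    by apply: sp_eq (sp_addl Sle (k%:R * (t * m%:R)) n%:R) _ _; ring.
  apply: (@sp_trans _ _ Sle (n%:R + k%:R * (t * b))); first exact: sp_iter_cancel.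
  have ntb1 := sp_mul2 Sle (sp_refl Sle n%:R) tb1.
  by apply: sp_eq (sp_add Sle (k%:R * (t * b)) ntb1) _ _; ring.
rewrite natrX; apply: (@sp_trans _ _ Sle ((k * m)%:R ^+ N * t)).
  by have := sp_mul2 Sle (sp_refl Sle ((k * m)%:R ^+ N)) t1; rewrite mulr1.
apply: (sp_trans Sle (sp_cancel_exp N step)); rewrite [c%:R * _]mulrC.
exact: sp_mul2 (sp_refl Sle _) tc.
Qed.

(** The two cases are whether [s a <= m] can be adjoined to [le]. *)
Theorem spectral_dichotomy (R : realType) (a : T) (m s : nat) :
  (exists2 phi : T -> R, spectral_point le phi & s%:R * phi a <= m%:R) \/
  (exists c n : nat, forall k N,
    le ((k * m) ^ N)%:R ((c * ((k + n) * s) ^ N)%:R * a ^+ N)).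
Proof.
have [Sam|nSam] := pselect (strassen_preorder (adjoin le (s%:R * a) m%:R)).
  left; have [le' [Sle' lele' tot]] := strassen_total_ext Sam.
  have [add mul nat mono] := cut_point_spectral R Sle' tot.
  exists (cut_point R le').
    by split=> // x y xy; apply: mono; apply: lele'; exact: sub_adjoin.
  rewrite -nat -mul -nat; apply/mono/lele'; exact: adjoin_le.
right; have [n [t ntb]] := adjoin_defect Sle nSam.
have [c cP] := defect_growth ntb; exists c, n => k N.
apply: sp_eq (cP k N) _ _ => //.
by rewrite natrM -mulrA natrX -exprMn_comm ?mulrA -?natrM//; exact: mulrC.
Qed.

End Duality.

(** * Cohomomorphisms and graph operations *)

(** Adjacency or equality.  Cohomomorphisms are the maps that reflect it, and it
    turns strong products into conjunctions, with no exception on the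
    diagonal. *)
Definition closed_adj (G : sgraph) : rel G := fun u v => (u == v) || adj u v.

Lemma cohomP (G H : sgraph) (f : G -> H) :
  cohom f <-> forall u v, closed_adj (f u) (f v) -> closed_adj u v.
Proof.
split=> cf u v; rewrite /closed_adj.
  apply: contraLR; rewrite !negb_or => /andP[uv nuv].
  by have [-> ->] := cf u v uv nuv.
move=> uv nuv; apply/andP; rewrite -negb_or; apply: contra (cf u v) _.
by rewrite /closed_adj negb_or uv.
Qed.

Lemma closed_adj_refl (G : sgraph) (u : G) : closed_adj u u.
Proof. by rewrite /closed_adj eqxx. Qed.

Lemma closed_adj_union (G H : sgraph) (u v : sunion G H) :
  closed_adj u v = match u, v with
                   | inl a, inl b => closed_adj a b
                   | inr x, inr y => closed_adj x y
                   | _, _ => false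
                   end.
Proof. by case: u v => [a|x] [b|y]. Qed.

Lemma closed_adj_prod (G H : sgraph) (u v : strong_prod G H) :
  closed_adj u v = closed_adj u.1 v.1 && closed_adj u.2 v.2.
Proof.
case: u v => [a x] [b y]; rewrite /closed_adj /adj /= /strong_adj /=.
have [[-> ->]|//] := eqVneq (a, x) (b, y).
by rewrite !eqxx.
Qed.

Lemma closed_adj_edgeless n (u v : edgeless n) : closed_adj u v = (u == v).
Proof. by rewrite /closed_adj orbF. Qed.

Lemma cohom_le_intro (G H : sgraph) (f : G -> H) :
  (forall u v, closed_adj (f u) (f v) -> closed_adj u v) -> cohom_le G H.
Proof. by move=> /cohomP cf; exists f. Qed.

Lemma cohom_le_refl G : cohom_le G G.
Proof. exact: (@cohom_le_intro _ _ id). Qed.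

Lemma cohom_le_trans G H K : cohom_le G H -> cohom_le H K -> cohom_le G K.
Proof.
move=> [f /cohomP cf] [g /cohomP cg].
by apply: (@cohom_le_intro _ _ (g \o f)) => u v /cg/cf.
Qed.

Lemma cohom_le_union G G' H H' :
  cohom_le G G' -> cohom_le H H' -> cohom_le (sunion G H) (sunion G' H').
Proof.
move=> [f /cohomP cf] [g /cohomP cg].
pose h (u : sunion G H) : sunion G' H' :=
  match u with inl a => inl (f a) | inr x => inr (g x) end.
apply: (@cohom_le_intro _ _ h) => -[a|x] [b|y]; rewrite !closed_adj_union //=.
  exact: cf.
exact: cg.
Qed.

Lemma cohom_le_prod G G' H H' :
  cohom_le G G' -> cohom_le H H' ->
  cohom_le (strong_prod G H) (strong_prod G' H').
Proof.
move=> [f /cohomP cf] [g /cohomP cg].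
pose h (u : strong_prod G H) : strong_prod G' H' := (f u.1, g u.2).
apply: (@cohom_le_intro _ _ h) => u v; rewrite !closed_adj_prod.
by move=> /andP[/cf -> /cg].
Qed.

Definition cohom_equiv G H := cohom_le G H /\ cohom_le H G.

Lemma cohom_equiv_iso (G H : sgraph) (f : G -> H) (g : H -> G) :
  cancel g f -> (forall u v, closed_adj (f u) (f v) = closed_adj u v) ->
  cohom_equiv G H.
Proof.
move=> gK fE; split; first by apply: (@cohom_le_intro _ _ f) => u v; rewrite fE.
by apply: (@cohom_le_intro _ _ g) => u v; rewrite -fE !gK.
Qed.

Lemma edgeless_le m n : cohom_le (edgeless m) (edgeless n) <-> (m <= n)%N.
Proof.
split=> [[f /cohomP cf]|mn].
  have := @leq_card _ _ f; rewrite !card_ord; apply=> u v fuv.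
  apply/eqP; rewrite -closed_adj_edgeless; apply: cf.
  by rewrite fuv closed_adj_refl.
apply: (@cohom_le_intro (edgeless m) (edgeless n) (widen_ord mn)) => u v.
by rewrite !closed_adj_edgeless => /eqP[/val_inj ->].
Qed.

Lemma le_edgeless_card (G : sgraph) : cohom_le G (edgeless #|G|).
Proof.
apply: (@cohom_le_intro G (edgeless #|G|) (fun u => enum_rank u)) => u v.
by rewrite closed_adj_edgeless => /eqP/enum_rank_inj ->; exact: closed_adj_refl.
Qed.

Definition from_edgeless0 (A : Type) (i : edgeless 0) : A :=
  let: Ordinal _ h := i in False_rect A (notF h).

Lemma empty_or_ge1 (G : sgraph) :
  cohom_equiv G (edgeless 0) \/ cohom_le (edgeless 1) G.
Proof.
have [u _|G0] := pickP (@predT G).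
  right; apply: (@cohom_le_intro (edgeless 1) G (fun=> u)) => i j _.
  by rewrite closed_adj_edgeless !ord1.
left; split; first by have := le_edgeless_card G; rewrite (eq_card0 G0).
by apply: (@cohom_le_intro (edgeless 0) G (@from_edgeless0 G)) => -[].
Qed.

Lemma unionC G H : cohom_equiv (sunion G H) (sunion H G).
Proof.
pose sw G H (u : sunion G H) : sunion H G :=
  match u with inl a => inr a | inr x => inl x end.
by apply: (@cohom_equiv_iso _ _ (sw G H) (sw H G)) => [[]//|[a|x] [b|y]];
  rewrite !closed_adj_union.
Qed.

Lemma unionA G H K :
  cohom_equiv (sunion G (sunion H K)) (sunion (sunion G H) K).
Proof.
pose f (u : sunion G (sunion H K)) : sunion (sunion G H) K :=
  match u with
  | inl a => inl (inl a) | inr (inl b) => inl (inr b) | inr (inr c) => inr c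
  end.
pose g (u : sunion (sunion G H) K) : sunion G (sunion H K) :=
  match u with
  | inl (inl a) => inl a | inl (inr b) => inr (inl b) | inr c => inr (inr c)
  end.
by apply: (@cohom_equiv_iso _ _ f g) => [[[]|]//|[a|[b|c]] [a'|[b'|c']]];
  rewrite !closed_adj_union.
Qed.

Lemma union0 G : cohom_equiv (sunion (edgeless 0) G) G.
Proof.
pose f (u : sunion (edgeless 0) G) : G :=
  match u with inl i => from_edgeless0 G i | inr a => a end.
by apply: (@cohom_equiv_iso _ _ f inr) => // -[[]//|a] [[]//|b].
Qed.

Lemma prodC G H : cohom_equiv (strong_prod G H) (strong_prod H G).
Proof.
pose sw G H (u : strong_prod G H) : strong_prod H G := (u.2, u.1).
apply: (@cohom_equiv_iso _ _ (sw G H) (sw H G)) => [[]//|u v].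
by rewrite !closed_adj_prod andbC.
Qed.

Lemma prodA G H K :
  cohom_equiv (strong_prod G (strong_prod H K))
              (strong_prod (strong_prod G H) K).
Proof.
pose f (u : strong_prod G (strong_prod H K)) : strong_prod (strong_prod G H) K :=
  ((u.1, u.2.1), u.2.2).
pose g (u : strong_prod (strong_prod G H) K) : strong_prod G (strong_prod H K) :=
  (u.1.1, (u.1.2, u.2)).
apply: (@cohom_equiv_iso _ _ f g) => [[[]]//|u v].
by rewrite !closed_adj_prod andbA.
Qed.

Lemma prod1 G : cohom_equiv (strong_prod (edgeless 1) G) G.
Proof.
pose f (u : strong_prod (edgeless 1) G) : G := u.2.
pose g (a : G) : strong_prod (edgeless 1) G := (ord0, a).
apply: (@cohom_equiv_iso _ _ f g) => // u v.
by rewrite closed_adj_prod closed_adj_edgeless [u.1]ord1 [v.1]ord1 eqxx.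
Qed.

Lemma prod0 G : cohom_equiv (strong_prod (edgeless 0) G) (edgeless 0).
Proof.
pose f (u : strong_prod (edgeless 0) G) : edgeless 0 := u.1.
pose g (i : edgeless 0) : strong_prod (edgeless 0) G :=
  from_edgeless0 _ i.
by apply: (@cohom_equiv_iso _ _ f g); [case|case; case].
Qed.

Lemma prodDl G H K :
  cohom_equiv (strong_prod (sunion G H) K)
              (sunion (strong_prod G K) (strong_prod H K)).
Proof.
pose f (u : strong_prod (sunion G H) K) :
    sunion (strong_prod G K) (strong_prod H K) :=
  match u with (inl a, c) => inl (a, c) | (inr b, c) => inr (b, c) end.
pose g (u : sunion (strong_prod G K) (strong_prod H K)) :
    strong_prod (sunion G H) K :=
  match u with inl p => (inl p.1, p.2) | inr p => (inr p.1, p.2) end.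
by apply: (@cohom_equiv_iso _ _ f g) => [[[]|[]]//|[[a|b] c] [[a'|b'] c']];
  rewrite closed_adj_union !closed_adj_prod /= ?closed_adj_union
    ?closed_adj_prod.
Qed.

Lemma edgelessS n :
  cohom_equiv (edgeless n.+1) (sunion (edgeless 1) (edgeless n)).
Proof.
pose f (i : edgeless n.+1) : sunion (edgeless 1) (edgeless n) :=
  if unlift ord0 i is Some j then inr j else inl ord0.
pose g (u : sunion (edgeless 1) (edgeless n)) : edgeless n.+1 :=
  match u with inl _ => ord0 | inr j => lift ord0 j end.
apply: (@cohom_equiv_iso _ _ f g) => [[i|j]|i j].
- by rewrite /f /g unlift_none [i]ord1.
- by rewrite /f /g liftK.
- rewrite /f closed_adj_edgeless.
  case: unliftP => [i'|] ->; case: unliftP => [j'|] ->;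
    by rewrite closed_adj_union ?closed_adj_edgeless ?eqxx//
      (inj_eq (@lift_inj _ _)).
Qed.

(** * The semiring of graph classes *)

(** A number of vertices and a list of edges: any such pair is read as a graph by
    symmetrizing the list and ignoring loops and out-of-range entries. *)
Definition graph_code : choiceType := (nat * seq (nat * nat))%type.

Definition decode_adj (c : graph_code) : rel 'I_c.1 := fun i j =>
  (i != j) && (((i : nat, j : nat) \in c.2) || ((j : nat, i : nat) \in c.2)).

Lemma decode_adj_sym c : symmetric (@decode_adj c).
Proof. by move=> i j; rewrite /decode_adj eq_sym orbC. Qed.

Lemma decode_adj_irr c : irreflexive (@decode_adj c).
Proof. by move=> i; rewrite /decode_adj eqxx. Qed.

Definition decode (c : graph_code) : sgraph :=
  SGraph (@decode_adj_sym c) (@decode_adj_irr c).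

Definition encode (G : sgraph) : graph_code :=
  (#|G|, [seq (enum_rank p.1 : nat, enum_rank p.2 : nat)
         | p <- enum [pred p : G * G | adj p.1 p.2]]).

(** The codes lose nothing up to cohomomorphic equivalence, so the classes of
    codes account for all graphs. *)
Lemma encodeK G : cohom_equiv G (decode (encode G)).
Proof.
pose f (u : G) : decode (encode G) := enum_rank u.
pose g (i : decode (encode G)) : G := enum_val i.
apply: (@cohom_equiv_iso _ _ f g) => [i|u v]; first exact: enum_valK.
have mem (a b : G) :
    ((enum_rank a : nat, enum_rank b : nat) \in (encode G).2) = adj a b.
  apply/mapP/idP => [[[a' b']]|ab]; last by exists (a, b); rewrite ?mem_enum.
  rewrite mem_enum inE /= => ab'.
  by move=> [/val_inj/enum_rank_inj-> /val_inj/enum_rank_inj->].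
rewrite /closed_adj {1}/adj /= /decode_adj !mem (inj_eq enum_rank_inj).
by rewrite (adj_sym v) orbb; case: eqVneq.
Qed.

Definition code_equiv : rel graph_code :=
  fun c d => `[< cohom_equiv (decode c) (decode d) >].

Lemma cohom_equiv_sym G H : cohom_equiv G H -> cohom_equiv H G.
Proof. by case. Qed.

Lemma cohom_equiv_trans G H K :
  cohom_equiv G H -> cohom_equiv H K -> cohom_equiv G K.
Proof.
move=> [GH HG] [HK KH].
by split; [apply: cohom_le_trans HK|apply: cohom_le_trans HG].
Qed.

Lemma code_equiv_refl : reflexive code_equiv.
Proof. by move=> c; apply/asboolP; split; exact: cohom_le_refl. Qed.

Lemma code_equiv_sym : symmetric code_equiv.
Proof. by move=> c d; apply/asboolP/asboolP; exact: cohom_equiv_sym. Qed.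

Lemma code_equiv_trans : transitive code_equiv.
Proof.
move=> d c e /asboolP cd /asboolP de; apply/asboolP.
exact: cohom_equiv_trans de.
Qed.

Canonical code_equiv_rel :=
  EquivRel code_equiv code_equiv_refl code_equiv_sym code_equiv_trans.

Definition graph_class := {eq_quot code_equiv}%qT.
HB.instance Definition _ := Choice.on graph_class.

Definition cls (G : sgraph) : graph_class := (\pi_graph_class (encode G))%qT.

Definition rep (x : graph_class) : sgraph := decode (repr x).

Lemma cls_eq G H : cls G = cls H <-> cohom_equiv G H.
Proof.
have GE := encodeK G; have HE := encodeK H.
split=> [/eqmodP/asboolP GH|GH].
  exact: cohom_equiv_trans GE (cohom_equiv_trans GH (cohom_equiv_sym HE)).
apply/eqmodP/asboolP.
exact: cohom_equiv_trans (cohom_equiv_sym GE) (cohom_equiv_trans GH HE).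
Qed.

Lemma repK x : cls (rep x) = x.
Proof.
rewrite -[RHS]reprK; apply/eqmodP/asboolP/cohom_equiv_sym; exact: encodeK.
Qed.

Lemma rep_cls G : cohom_equiv (rep (cls G)) G.
Proof. by apply/cls_eq; rewrite repK. Qed.

(** The operations go through representatives; they do not depend on the
    choice because union and strong product are monotone for cohomomorphisms. *)
Definition class_zero := cls (edgeless 0).
Definition class_one := cls (edgeless 1).
Definition class_add x y := cls (sunion (rep x) (rep y)).
Definition class_mul x y := cls (strong_prod (rep x) (rep y)).

Lemma class_addE G H : class_add (cls G) (cls H) = cls (sunion G H).
Proof.
apply/cls_eq; have [GG' G'G] := rep_cls G; have [HH' H'H] := rep_cls H.
by split; exact: cohom_le_union.
Qed.

Lemma class_mulE G H : class_mul (cls G) (cls H) = cls (strong_prod G H).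
Proof.
apply/cls_eq; have [GG' G'G] := rep_cls G; have [HH' H'H] := rep_cls H.
by split; exact: cohom_le_prod.
Qed.

Lemma class_addA : associative class_add.
Proof.
move=> x y z; rewrite -(repK x) -(repK y) -(repK z) !class_addE.
by apply/cls_eq; exact: unionA.
Qed.

Lemma class_addC : commutative class_add.
Proof. by move=> x y; apply/cls_eq; exact: unionC. Qed.

Lemma class_add0 : left_id class_zero class_add.
Proof. by move=> x; rewrite -(repK x) class_addE; apply/cls_eq; exact: union0. Qed.

HB.instance Definition _ :=
  GRing.isNmodule.Build graph_class class_addA class_addC class_add0.

Lemma class_mulA : associative class_mul.
Proof.
move=> x y z; rewrite -(repK x) -(repK y) -(repK z) !class_mulE.
by apply/cls_eq; exact: prodA.
Qed.

Lemma class_mulC : commutative class_mul.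
Proof. by move=> x y; apply/cls_eq; exact: prodC. Qed.

Lemma class_mul1 : left_id class_one class_mul.
Proof. by move=> x; rewrite -(repK x) class_mulE; apply/cls_eq; exact: prod1. Qed.

Lemma class_mulDl : left_distributive class_mul class_add.
Proof.
move=> x y z; rewrite -(repK x) -(repK y) -(repK z).
rewrite !(class_addE, class_mulE); apply/cls_eq; exact: prodDl.
Qed.

Lemma class_mul0 : left_zero class_zero class_mul.
Proof. by move=> x; rewrite -(repK x) class_mulE; apply/cls_eq; exact: prod0. Qed.

HB.instance Definition _ := GRing.Nmodule_isComPzSemiRing.Build graph_class
  class_mulA class_mulC class_mul1 class_mulDl class_mul0.

Lemma cls_union G H : cls (sunion G H) = cls G + cls H.
Proof. by rewrite -class_addE. Qed.

Lemma cls_prod G H : cls (strong_prod G H) = cls G * cls H.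
Proof. by rewrite -class_mulE. Qed.

Lemma cls_edgeless n : cls (edgeless n) = n%:R.
Proof.
elim: n => // n IHn; have /cls_eq -> := edgelessS n.
by rewrite cls_union IHn -natr1 addrC.
Qed.

Lemma cls_pow G n : cls (strong_pow G n) = cls G ^+ n.
Proof. by elim: n => [//|n IHn]; rewrite exprS -IHn -cls_prod. Qed.

Definition class_le (x y : graph_class) : Prop := cohom_le (rep x) (rep y).

Lemma class_leE G H : class_le (cls G) (cls H) <-> cohom_le G H.
Proof.
have [GG' G'G] := rep_cls G; have [HH' H'H] := rep_cls H; split=> GH.
  exact: cohom_le_trans G'G (cohom_le_trans GH HH').
exact: cohom_le_trans GG' (cohom_le_trans GH H'H).
Qed.

Lemma class_strassen : strassen_preorder class_le.
Proof.
split=> [x|y x z|z x y xy|z x y xy||x|x|n].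
- exact: cohom_le_refl.
- exact: cohom_le_trans.
- by apply/class_leE/cohom_le_union => //; exact: cohom_le_refl.
- by apply/class_leE/cohom_le_prod => //; exact: cohom_le_refl.
- by apply/class_leE/edgeless_le.
- rewrite -(repK x).
  by have [/cls_eq ->|/class_leE] := empty_or_ge1 (rep x); [left|right].
- exists #|rep x|; rewrite -{1}(repK x) -cls_edgeless; apply/class_leE.
  exact: le_edgeless_card.
- by rewrite -!cls_edgeless => /class_leE/edgeless_le; rewrite ltnn.
Qed.

(** * The Shannon capacity as an infimum *)

Lemma edgeless_leP (n : nat) (G : sgraph) :
  cohom_le (edgeless n) G <-> (n <= indep_num G)%N.
Proof.
split=> [[f cf]|nG].
  have f_inj : injective f.
    move=> i j fij; apply/eqP/negPn/negP => ij.
    by have [] := cf i j ij isT; rewrite fij eqxx.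
  have indf : independent (f @: 'I_n).
    apply/forall_inP => _ /imsetP[i _ ->]; apply/forall_inP => _ /imsetP[j _ ->].
    have [->|ij] := eqVneq i j; first by rewrite adj_irr.
    by have [] := cf i j ij isT.
  apply: leq_trans (leq_bigmax_cond (F := fun A : {set G} => #|A|) _ indf).
  by rewrite card_imset// card_ord.
apply: (@cohom_le_trans _ (edgeless (indep_num G))); first exact/edgeless_le.
have [|A indA Amax] := @eq_bigmax_cond _ (@independent G) (fun A => #|A|).
  apply/card_gt0P; exists (finset.set0 : {set G}).
  by apply/forall_inP => x; rewrite inE.
have -> : indep_num G = #|A| by exact: Amax.
exists (fun i : 'I_#|A| => enum_val i) => i j ij _.
rewrite (inj_eq enum_val_inj); split=> //.
by have /forall_inP/(_ _ (enum_valP i))/forall_inP/(_ _ (enum_valP j)) := indA.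
Qed.

(** An independent set meets each of the [k] copies of [G] in an independent
    set. *)
Lemma indep_num_scale (k : nat) (G : sgraph) :
  (indep_num (strong_prod (edgeless k) G) <= k * indep_num G)%N.
Proof.
apply/bigmax_leqP => A indA.
pose fiber (i : 'I_k) :=
  [set a : G | ((i, a) : strong_prod (edgeless k) G) \in A]%SET.
have -> : #|A| = (\sum_i #|fiber i|)%N.
  under eq_bigr do rewrite -sum1_card.
  rewrite -sum1_card pair_big_dep /=.
  by apply: eq_bigl => -[i a] /=; rewrite inE.
rewrite -[k in leqRHS]card_ord -sum_nat_const; apply: leq_sum => i _.
apply: (leq_bigmax_cond (F := fun B : {set G} => #|B|)).
apply/forall_inP => a; rewrite inE => ia.
apply/forall_inP => b; rewrite inE => ib.
have /forall_inP/(_ _ ia)/forall_inP/(_ _ ib) := indA.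
apply: contra => ab; apply/and3P; split; rewrite /= ?eqxx ?ab ?orbT//.
by apply: contraTneq ab => -[->]; rewrite adj_irr.
Qed.

Section Capacity.
Variable R : realType.

Lemma spectral_pow (F : sgraph -> R) (G : sgraph) n :
  asymptotic_spectrum F -> F (strong_pow G n) = F G ^+ n.
Proof.
move=> SF; elim: n => [|n IHn]; first by rewrite expr0 (spectral_edgeless SF).
by rewrite exprS -IHn -(spectral_prod SF).
Qed.

Lemma indep_num_spectral (F : sgraph -> R) (G : sgraph) n :
  asymptotic_spectrum F -> (indep_num (strong_pow G n))%:R <= F G ^+ n.
Proof.
move=> SF; rewrite -(spectral_pow _ _ SF) -(spectral_edgeless SF).
by apply: (spectral_le SF); exact/edgeless_leP.
Qed.

Lemma point_spectrum (phi : graph_class -> R) :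
  spectral_point class_le phi -> asymptotic_spectrum (fun G => phi (cls G)).
Proof.
move=> [add mul nat mono]; split=> [G|G H|G H|n|G H GH].
- rewrite -[0](nat 0%N); apply: mono; exact: (sp_ge0 class_strassen).
- by rewrite cls_union.
- by rewrite cls_prod.
- by rewrite cls_edgeless.
- by apply/mono/class_leE.
Qed.

Lemma spectrum_nonempty : exists F : sgraph -> R, asymptotic_spectrum F.
Proof.
have [le [Sle cle tot]] := strassen_total_ext class_strassen.
have [add mul nat mono] := cut_point_spectral R Sle tot.
exists (fun G => cut_point R le (cls G)); apply: point_spectrum.
by split=> // x y xy; exact/mono/cle.
Qed.

Lemma graph_dichotomy (G : sgraph) (m s : nat) :
  (exists2 F : sgraph -> R, asymptotic_spectrum F & s%:R * F G <= m%:R) \/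
  (exists c n : nat, forall k N,
    ((k * m) ^ N <= c * ((k + n) * s) ^ N * indep_num (strong_pow G N))%N).
Proof.
have [[phi phiP phiG]|[c [n cP]]] :=
    spectral_dichotomy class_strassen R (cls G) m s; [left|right].
  by exists (fun G => phi (cls G)) => //; exact: point_spectrum.
exists c, n => k N; apply: leq_trans (indep_num_scale _ _).
apply/edgeless_leP/class_leE.
by rewrite cls_prod cls_pow !cls_edgeless; exact: cP.
Qed.

(** The base [k m / ((k + n) s)] tends to [m / s] as [k] grows, so for some [k] it
    exceeds [x]; the surplus then absorbs the constant [c] as [N] grows. *)
Lemma growth_lower_bound (u : nat -> nat) (m s c n : nat) (x : R) :
  (forall k N, ((k * m) ^ N <= c * ((k + n) * s) ^ N * u N)%N) ->
  (0 < s)%N -> 0 <= x -> x * s%:R < m%:R ->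
  \forall N \near \oo, x ^+ N <= (u N)%:R.
Proof.
move=> uP s0 x0 xsm.
(* At [N = 0] the hypothesis reads [1 <= c * u 0]. *)
have c0 : (0 < c)%N by have := uP 0%N 0%N; rewrite !expn0 muln1; case: c {uP}.
(* [k0] solves [x (k0 + n) s < k0 m], which is linear in [k0]. *)
have [k0 k0P] : exists k : nat, (x * n%:R * s%:R) / (m%:R - x * s%:R) < k%:R.
  eexists; apply: archi_boundP; apply: divr_ge0; last by rewrite subr_ge0 ltW.
  by rewrite !mulr_ge0.
pose k := k0.+1; pose y := x * ((k + n) * s)%:R.
have ykm : y < (k * m)%:R.
  move: k0P; rewrite ltr_pdivrMr ?subr_gt0// => k0P.
  rewrite /y /k !natrM natrD -natr1.
  by have := ltW xsm; lra.
have y0 : 0 <= y by rewrite mulr_ge0.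
have km0 : 0 < (k * m)%:R :> R by exact: le_lt_trans ykm.
have z1 : `|y / (k * m)%:R| < 1.
  by rewrite ger0_norm ?divr_ge0// ltr_pdivrMr// mul1r.
have c0R : 0 < (c%:R : R)^-1 by rewrite invr_gt0 ltr0n.
near=> N; have : (y / (k * m)%:R) ^+ N < (c%:R)^-1.
  by near: N; exact: cvgr_lt (cvg_expr z1) _ c0R.
rewrite exprMn exprVn ltr_pdivrMr ?exprn_gt0// mulrC.
rewrite ltr_pdivlMr ?ltr0n// => /ltW yN.
have kn0 : 0 < (c * ((k + n) * s) ^ N)%:R :> R.
  by rewrite ltr0n muln_gt0 c0 expn_gt0 muln_gt0 s0 addSn.
rewrite -(ler_pM2l kn0) -natrM; apply: le_trans (_ : ((k * m) ^ N)%:R <= _).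
  rewrite natrM !natrX -mulrA -exprMn [_%:R * x]mulrC [leLHS]mulrC.
  exact: yN.
by rewrite ler_nat.
Unshelve. all: by end_near.
Qed.

Lemma root_expK (x : R) (n : nat) : 0 <= x -> (x ^+ n.+1) `^ (n.+1%:R^-1) = x.
Proof.
by move=> x0; rewrite -powR_mulrn// -powRrM mulfV ?powRr1// pnatr_eq0.
Qed.

Definition spectral_values (G : sgraph) : set R :=
  [set x | exists2 F : sgraph -> R, asymptotic_spectrum F & x = F G].

Lemma has_inf_spectral_values G : has_inf (spectral_values G).
Proof.
split; first by have [F SF] := spectrum_nonempty; exists (F G), F.
by exists 0 => _ [F SF ->]; exact: spectral_ge0.
Qed.

(** The terms with positive index are at most the infimum.  For the lower bound,
    given [e] there is a rational [m / s] strictly between [L - e] and the infimum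
    [L]; no spectral value is at most [m / s], so the dichotomy provides growth
    at every rate below [m / s]. *)
Theorem cvg_shannon_capacity (G : sgraph) :
  (indep_num (strong_pow G n))%:R `^ (n%:R^-1) @[n --> \oo]
    --> inf (spectral_values G).
Proof.
have [vals0 lb] := has_inf_spectral_values G; set L := inf _.
have upper n : (indep_num (strong_pow G n.+1))%:R `^ (n.+1%:R^-1) <= L.
  apply: lb_le_inf => // _ [F SF ->].
  rewrite -[leRHS](@root_expK _ n); last exact: spectral_ge0.
  apply: ge0_ler_powR; rewrite ?invr_ge0 ?nnegrE ?exprn_ge0//.
    exact: spectral_ge0.
  exact: indep_num_spectral.
apply/cvgrPdist_le => e e0.
suff lower : \forall n \near \oo,
    L - e <= (indep_num (strong_pow G n))%:R `^ (n%:R^-1).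
  near=> n; have n0 : (0 < n)%N by near: n; exact: nbhs_infty_gt.
  have lo : L - e <= (indep_num (strong_pow G n))%:R `^ (n%:R^-1) by near: n.
  move: lo; have := upper n.-1; rewrite prednK// => up lo.
  by rewrite ger0_norm ?subr_ge0// lerBlDr addrC -lerBlDr.
have [x0|x0] := ltP (L - e) 0.
  by apply: nearW => n; apply: le_trans (ltW x0) _; exact: powR_ge0.
(* With [1 / s < e], some multiple of [1 / s] lies between [L - e] and [L]. *)
have [s eS] : exists s : nat, e^-1 < s%:R.
  by eexists; apply: archi_boundP; rewrite invr_ge0 ltW.
have s0 : 0 < s%:R :> R by apply: lt_trans eS; rewrite invr_gt0.
have es : 1 < e * s%:R by rewrite mulrC -ltr_pdivrMr// mul1r.
have /andP[tle tlt] := truncn_itv (mulr_ge0 x0 (ltW s0)).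
set t := Num.truncn _ in tle tlt.
have tL : t.+1%:R < s%:R * L by rewrite -natr1; lra.
have [[F SF FG]|[c [n cP]]] := graph_dichotomy G t.+1 s.
  have : L <= F G by apply: ge_inf => //; exists F.
  by rewrite -(ler_pM2l s0) => LF; lra.
have s0' : (0 < s)%N by rewrite -(ltr0n R).
have := growth_lower_bound cP s0' x0 tlt.
move=> grow; near=> N; have N0 : (0 < N)%N by near: N; exact: nbhs_infty_gt.
have gN : (L - e) ^+ N <= (indep_num (strong_pow G N))%:R by near: N.
rewrite -[leLHS](@root_expK _ N.-1)// prednK//.
by apply: ge0_ler_powR; rewrite ?invr_ge0 ?nnegrE ?exprn_ge0.
Unshelve. all: by end_near.
Qed.

Lemma shannon_capacityE (G : sgraph) :
  shannon_capacity R G = inf (spectral_values G).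
Proof. exact: cvg_lim (@cvg_shannon_capacity G). Qed.

Lemma inf_spectral_values_le (G H : sgraph) (e : R) :
  (forall F : sgraph -> R, asymptotic_spectrum F -> F G <= F H + e) ->
  inf (spectral_values G) <= inf (spectral_values H) + e.
Proof.
have [_ lbG] := has_inf_spectral_values G.
have [H0 _] := has_inf_spectral_values H.
move=> GHe; rewrite -lerBlDr; apply: lb_le_inf => // _ [F SF ->].
rewrite lerBlDr; apply: le_trans (GHe F SF).
by apply: ge_inf => //; exists F.
Qed.

End Capacity.

(** * Continuity of the Shannon capacity *)

Theorem lemma2p7 (R : realType) (G : nat -> sgraph) (H : sgraph)
    (hGH : spectrum_dist R (G i) H @[i --> \oo] --> (0%R)%:E) :
  shannon_capacity R (G i) @[i --> \oo] --> shannon_capacity R H.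
Proof.
apply/cvgrPdist_le => e e0.
have e0E : ((0%R)%:E < e%:E)%E by rewrite lte_fin.
have dist_near := hGH _ (open_ereal_lt' e0E).
near=> i; have dist_lt : (spectrum_dist R (G i) H < e%:E)%E by near: i.
have close (F : sgraph -> R) : asymptotic_spectrum F -> `|F (G i) - F H| <= e.
  move=> SF; rewrite -lee_fin; apply: le_trans (ltW dist_lt).
  by apply: ereal_sup_ubound; exists F.
rewrite !shannon_capacityE distrC ler_distl lerBlDr; apply/andP; split;
  apply: inf_spectral_values_le => F /close; rewrite ler_distl lerBlDr;
  by case/andP.
Unshelve. all: by end_near.
Qed.
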